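(* The following three statements are equivalent: (1) $\mathfrak{m}_c = \mathfrak{c}$; (2) everywhere selective independent families exist generically, i.e. every independent family $I$ on $\omega$ with $|I| < \mathfrak{c}$ is contained in some everywhere selective independent family $I' \supseteq I$ on $\omega$; (3) selective independent families exist generically, i.e. every independent family $I$ on $\omega$ with $|I| < \mathfrak{c}$ is contained in some selective independent family $I' \supseteq I$ on $\omega$.
   Context: A ''function on $\omega$'' means a function $f:\omega\to\omega$. For $A \subseteq \omega$ let $A^0 = A$ and $A^1 = \omega\setminus A$. For a set $I$, $\mathrm{FF}(I)$ is the set of functions $h$ with finite domain $\mathrm{dom}(h)\subseteq I$ and values in $2=\{0,1\}$; for $h \in \mathrm{FF}(I)$ let $I^h = \bigcap\{A^{h(A)} : A \in \mathrm{dom}(h)\}$ (with $I^\emptyset=\omega$). An infinite family $I$ of subsets of $\omega$ is independent if $I^h \neq \emptyset$ for every $h \in \mathrm{FF}(I)$; all independent families considered are infinite. The envelope of $I$ is $\mathrm{ENV}(I) = \{I^h : h \in \mathrm{FF}(I)\}$. An independent family $I$ is selective if for every function $f$ on $\omega$ there is $E \in \mathrm{ENV}(I)$ such that $f\restriction E$ is one-to-one or constant. It is everywhere selective if for every function $f$ on $\omega$ and every $h \in \mathrm{FF}(I)$ there is $k \in \mathrm{FF}(I)$ with $h \subseteq k$ such that $f \restriction I^k$ is one-to-one or constant. $\mathfrak{c}$ is the cardinality of the set of functions on $\omega$. $\mathfrak{m}_c$ is the minimum cardinality of a family $H$ of functions on $\omega$ such that for every function $g$ on $\omega$ there is $h \in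 H$ with $g(n) \neq h(n)$ for all $n \in \omega$. *)

(* Defs.v *)
From mathcomp Require Import all_boot finmap.
From mathcomp Require Import boolp classical_sets functions cardinality.

Set Implicit Arguments.
Unset Strict Implicit.
Unset Printing Implicit Defensive.

Local Open Scope classical_set_scope.
Local Open Scope card_scope.
Local Open Scope fmap_scope.

(* The values 0 and 1 in 2 are encoded as false and true, so that
   A^0 = A and A^1 = omega \ A. *)
Definition signed_set (A : set nat) (b : bool) : set nat :=
  if b then ~` A else A.

Definition FF (I : set (set nat)) : set {fmap set nat -> bool} :=
  [set h | [set` domf h] `<=` I].

(* The intersection ranges over the graph of h; this is I^h, which depends
   on h only, and it is [set: nat] when h is empty. *)
Definition cell (h : {fmap set nat -> bool}) : set nat :=
  \bigcap_(p in [set p : set nat * bool | h.[? p.1] = Some p.2])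
    signed_set p.1 p.2.

Definition fmap_extends (h k : {fmap set nat -> bool}) : Prop :=
  forall A b, h.[? A] = Some b -> k.[? A] = Some b.

Definition independent_family (I : set (set nat)) : Prop :=
  infinite_set I /\ forall h, FF I h -> cell h !=set0.

Definition ENV (I : set (set nat)) : set (set nat) := cell @` FF I.

Definition constant_on (E : set nat) (f : nat -> nat) : Prop :=
  exists c, forall n, E n -> f n = c.

Definition selective (I : set (set nat)) : Prop :=
  forall f : nat -> nat,
    exists2 E, ENV I E & set_inj E f \/ constant_on E f.

Definition everywhere_selective (I : set (set nat)) : Prop :=
  forall (f : nat -> nat) h, FF I h ->
    exists k, [/\ FF I k, fmap_extends h k &
                  set_inj (cell k) f \/ constant_on (cell k) f].

Definition card_lt T U (A : set T) (B : set U) : Prop :=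
  (A #<= B) /\ ~ (B #<= A).

(* A representative of the cardinal c. *)
Definition continuum : set (nat -> nat) := setT.

Definition mc_family (H : set (nat -> nat)) : Prop :=
  forall g : nat -> nat, exists2 h, H h & forall n, g n <> h n.

(* Cardinals are represented by sets: [is_mc K] says that the cardinality of K
   is the minimum of the cardinalities of the families in [mc_family]. *)
Definition is_mc T (K : set T) : Prop :=
  (exists2 H, mc_family H & (H #= K)) /\
  (forall H, mc_family H -> (K #<= H)).

Definition exist_generically (P : set (set nat) -> Prop) : Prop :=
  forall I, independent_family I -> card_lt I continuum ->
    exists I', [/\ independent_family I', P I' & I `<=` I'].

(* Main.v *)
From Stdlib Require Import Inverse_Image.
From mathcomp Require Import all_boot finmap.
From mathcomp Require Import boolp classical_sets functions cardinality wochoice.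
Require Import Defs.

(* From (1) to (2): fewer than m_c
   partial functions with infinite domains can all be matched somewhere by a
   single total function.  Given f and a cell I^p, either f is already
   one-to-one or constant on a smaller cell, or some fiber of f meets every
   cell below a smaller I^q, or f takes infinitely many values on every cell
   below I^p; in the last case a matching function yields a set of
   representatives of the fibers of f that meets every cell below I^p.  In both
   nontrivial cases the set found splits every smaller cell, since f is neither
   one-to-one nor constant there, and adding it to I (modified outside the cell
   so as to stay independent) solves the task (f, p).  A recursion of length c
   solves all tasks.

   From (3) to (1): let H have fewer than c elements and contain, for each g, a
   function nowhere equal to g.  On the set of pairs (n, S), S a list of n + 1
   guesses at h restricted to a finite block of numbers, the sets
   X_h = {(n, S) : S contains the restriction of h} are independent.  The
   projection (n, S) |-> n is not constant on any cell of an extension, since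
   n + 2 of the X_h have no common point with a given n, and not one-to-one: a
   cell on which it is one-to-one provides n + 1 guesses for each n, hence a
   function g meeting all h whose X_h meets the cell. *)

Set Implicit Arguments.
Unset Strict Implicit.
Unset Printing Implicit Defensive.

Local Open Scope classical_set_scope.
Local Open Scope card_scope.
Local Open Scope fmap_scope.

(** * Cardinal arithmetic *)

Lemma card_le_fun T U (A : set T) (B : set U) (f : T -> U) :
  (forall x, A x -> B (f x)) -> set_inj A f -> A #<= B.
Proof.
move=> fAB fI.
have : $|{injfun A >-> B}| by apply/injfunPex; exists f.
by case=> g; exact: inj_card_le g.
Qed.

Lemma card_le_funP T U (A : set T) (B : set U) : U -> A #<= B ->
  exists2 f : T -> U, (forall x, A x -> B (f x)) & set_inj A f.
Proof.
move=> u /card_leP[g].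
exists (fun x => if pselect (A x) is left Ax
                 then val (g (SigSub (mem_set Ax))) else u).
  by move=> x Ax; case: pselect => // Ax'; apply: set_mem; exact: valP.
move=> x y /set_mem Ax /set_mem Ay; case: pselect => // {}Ax; case: pselect => // {}Ay.
move=> /val_inj /(inj (f:=g)) E.
by have /(congr1 val) := E (mem_set I) (mem_set I).
Qed.

Lemma card_le_graph T U (A : set T) (B : set U) (R : set (T * U)) :
    (forall x, A x -> exists2 y, B y & R (x, y)) ->
    (forall x x' y, A x -> A x' -> R (x, y) -> R (x', y) -> x = x') ->
  A #<= B.
Proof.
move=> tot inj.
have [[x Ax]|A0] := pselect (A !=set0); last first.
  by suff -> : A = set0 by []; apply/seteqP; split=> // x Ax; case: A0; exists x.
have [u _ _] := tot x Ax.
have /choice[f fP] : forall x, exists y, A x -> B y /\ R (x, y).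
  move=> z; have [/tot[y By Rzy]|nA] := pselect (A z); first by exists y.
  by exists u.
apply: (card_le_fun (f := f)) => [z /fP[]//|y z /set_mem Ay /set_mem Az E].
by apply: (inj _ _ (f y)) => //; [case: (fP y Ay)|rewrite E; case: (fP z Az)].
Qed.

(** Zorn's lemma gives a maximal partial injection [R] from [A] to [B]. It is total on [A] or onto
    [B], for otherwise an unmatched pair could be added. *)
Lemma card_le_total T U (A : set T) (B : set U) : (A #<= B) \/ (B #<= A).
Proof.
pose P (R : set (T * U)) :=
  [/\ R `<=` A `*` B, forall x x' y, R (x, y) -> R (x', y) -> x = x' &
      forall x y y', R (x, y) -> R (x, y') -> y = y'].
have [F FP chF|R [[RAB inj fn] maxR]] := @Zorn_bigcup _ P.
  have dir p q : (\bigcup_(X in F) X) p -> (\bigcup_(X in F) X) q ->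
      exists2 X, F X & X p /\ X q.
    move=> [X FX Xp] [Y FY Yq]; have [XY|YX] := chF X Y FX FY.
      by exists Y => //; split=> //; exact: XY.
    by exists X => //; split=> //; exact: YX.
  split=> [p [X /FP[sX _ _] /sX]//|x x' y p q|x y y' p q].
    by have [X /FP[_ injX _] [Xp Xq]] := dir _ _ p q; exact: injX Xp Xq.
  by have [X /FP[_ _ fX] [Xp Xq]] := dir _ _ p q; exact: fX Xp Xq.
have [tA|ntA] := pselect (forall x, A x -> exists2 y, B y & R (x, y)).
  by left; apply: card_le_graph tA _ => x x' y _ _; exact: inj.
have [tB|ntB] := pselect (forall y, B y -> exists2 x, A x & R (x, y)).
  right; apply: (@card_le_graph _ _ B A [set p | R (p.2, p.1)]) tB _.
  by move=> x x' y _ _; exact: fn.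
move/existsNP : ntA => [a /not_implyP[Aa na]].
move/existsNP : ntB => [b /not_implyP[Bb nb]].
have naR y : ~ R (a, y) by move=> Ray; apply: na; exists y => //; case: (RAB _ Ray).
have nbR x : ~ R (x, b) by move=> Rxb; apply: nb; exists x => //; case: (RAB _ Rxb).
exfalso; apply: (maxR (R `|` [set (a, b)])).
  split=> [p Rp|sub]; first by left.
  by apply: (naR b); apply: sub; right.
split=> [p [/RAB//|->//]|x x' y|x y y'].
- move=> [Rxy|[xa yb]] [Rxy'|[xa' yb']]; first exact: inj Rxy Rxy'.
  + by case: (nbR x); rewrite -yb'.
  + by case: (nbR x'); rewrite -yb.
  + by rewrite xa xa'.
- move=> [Rxy|[xa yb]] [Rxy'|[xa' yb']]; first exact: fn Rxy Rxy'.
  + by case: (naR y); rewrite -xa'.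
  + by case: (naR y'); rewrite -xa.
  + by rewrite yb yb'.
Qed.

(* A witness of [D `*` D #<= D], encoded as the graph of a map from pairs;
   the domain [D] is read off the graph. *)
Definition pairing_domain T (R : set (T * T * T)) : set T :=
  [set x | exists y z, R (x, y, z)].

Definition pairing_graph T (A : set T) (R : set (T * T * T)) :=
  let D := pairing_domain R in
  [/\ D `<=` A,
      exists a b, [/\ D a, D b & a <> b],
      forall x y z, R (x, y, z) -> D y /\ D z,
      forall x y, D x -> D y -> exists z, R (x, y, z) &
      forall x y x' y' z, R (x, y, z) -> R (x', y', z) -> x = x' /\ y = y'].

(* Two distinct points a and b of D give [D + D #<= D `*` D #<= D], which leaves
   room for extending the pairing of D to D `|` C as soon as [C `\` D #<= D]. *)
Lemma pairing_graph_absorb T (A : set T) (R : set (T * T * T)) (C : set T) :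
    pairing_graph A R -> (C `\` pairing_domain R #<= pairing_domain R) ->
  exists g : T -> T -> T,
    (forall x y, (pairing_domain R `|` C) x -> (pairing_domain R `|` C) y ->
      pairing_domain R (g x y)) /\
    (forall x y x' y',
      (pairing_domain R `|` C) x -> (pairing_domain R `|` C) y ->
      (pairing_domain R `|` C) x' -> (pairing_domain R `|` C) y' ->
      g x y = g x' y' -> x = x' /\ y = y').
Proof.
set D := pairing_domain R => -[DA [a [b [Da Db ab]]] clos tot inj].
move=> /(card_le_funP a)[psi psiD psiI].
have /choice[f0 f0P] : forall p : T * T, exists z,
    D p.1 -> D p.2 -> R (p.1, p.2, z).
  move=> [x y] /=; have [Dx|] := pselect (D x); last by exists a.
  have [Dy|] := pselect (D y); last by exists a.
  by have [z Rz] := tot x y Dx Dy; exists z.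
pose f x y := f0 (x, y).
have fP x y : D x -> D y -> R (x, y, f x y) by exact: f0P (x, y).
have fD x y : D x -> D y -> D (f x y).
  by move=> Dx Dy; case: (clos _ _ _ (fP x y Dx Dy)).
have fI x y x' y' : D x -> D y -> D x' -> D y' -> f x y = f x' y' ->
    x = x' /\ y = y'.
  move=> Dx Dy Dx' Dy' E; apply: (inj _ _ _ _ (f x y)); first exact: fP.
  by rewrite E; exact: fP.
pose e x := if pselect (D x) is left _ then f x a else f (psi x) b.
have eD x : (D `|` C) x -> D (e x).
  rewrite /e; case: pselect => [Dx _|nD [//|Cx]]; first exact: fD.
  by apply: fD => //; apply: psiD.
have eI x y : (D `|` C) x -> (D `|` C) y -> e x = e y -> x = y.
  rewrite /e; case: pselect => [Dx _|nDx [//|Cx]];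
    (case: pselect => [Dy _|nDy [//|Cy]]).
  - by move/fI => [].
  - by move/fI => [] //; exact: psiD.
  - by move/fI => [] //; [exact: psiD|move=> _ /esym].
  - move/fI => [] //; [exact: psiD|exact: psiD|].
    by move=> E _; apply: psiI => //; exact: mem_set.
exists (fun x y => f (e x) (e y)); split=> [x y Hx Hy|x y x' y' Hx Hy Hx' Hy'].
  by apply: fD; exact: eD.
by move=> /fI[]; [exact: eD|exact: eD|exact: eD|exact: eD|] => /eI -> // /eI ->.
Qed.

(** Take a maximal pairing, with domain [D]. If the rest of [A] embeds in [D], then [D] absorbs the
    square of [A]. Otherwise [D] has a copy [C] inside the rest, and the pairing extends to the
    union of [D] and [C] with its new values in [C]. *)
Lemma card_le_square T (A : set T) : infinite_set A -> A `*` A #<= A.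
Proof.
move=> /infiniteP Ainf.
have [t0 _] : A !=set0.
  by apply: infinite_setN0; exact/infiniteP.
have [u uA uI] := card_le_funP t0 Ainf.
have {}uI : injective u by move=> i j; apply: uI; exact: mem_set.
pose P R := R = set0 \/ pairing_graph A R.
have [F FP chF|R [PR maxR]] := @Zorn_bigcup _ P.
  have [F0|/existsNP[R0 /not_implyP[FR0 R0N]]] :=
      pselect (forall R, F R -> R = set0).
    by left; apply/seteqP; split=> // p [R /F0 ->].
  right; set U := \bigcup_(X in F) X.
  have dir p q : U p -> U q -> exists2 X, F X & X p /\ X q.
    move=> [X FX Xp] [Y FY Yq]; have [XY|YX] := chF X Y FX FY.
      by exists Y => //; split=> //; exact: XY.
    by exists X => //; split=> //; exact: YX.
  have FG X p : F X -> X p -> pairing_graph A X.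
    by move=> /FP[->//|].
  have DU X x : F X -> pairing_domain X x -> pairing_domain U x.
    by move=> FX [y [z Xxyz]]; exists y, z, X.
  split.
  - move=> x [y [z [X FX Xxyz]]]; have [s _ _ _ _] := FG _ _ FX Xxyz.
    by apply: s; exists y, z.
  - have [//|[_ [a [b [Da Db ab]]] _ _ _]] := FP R0 FR0.
    by exists a, b; split=> //; exact: DU FR0 _.
  - move=> x y z [X FX Xxyz]; have [_ _ /(_ _ _ _ Xxyz)[Dy Dz] _ _] := FG _ _ FX Xxyz.
    by split; exact: DU FX _.
  - move=> x y [x1 [x2 Ux]] [y1 [y2 Uy]]; have [X FX [Xx Xy]] := dir _ _ Ux Uy.
    have [_ _ _ tot _] := FG _ _ FX Xx.
    have [||z Xz] := tot x y; [by exists x1, x2|by exists y1, y2|].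
    by exists z, X.
  - move=> x y x' y' z Ux Uy; have [X FX [Xx Xy]] := dir _ _ Ux Uy.
    by have [_ _ _ _ inj] := FG _ _ FX Xx; exact: inj Xx Xy.
have {PR}GR : pairing_graph A R.
  case: PR => // R0; exfalso.
  (* A coding of pairs of numbers, moved to a countable subset of [A], beats the empty graph. *)
  pose R1 := [set p : T * T * T | exists i j,
     p = (u i, u j, u (choice.pickle (i, j)))].
  have DR1 i : pairing_domain R1 (u i) by exists (u i), (u (choice.pickle (i, i))), i, i.
  apply: (maxR R1).
    rewrite R0; split=> [p //|sub].
    have := sub (u 0, u 0, u (choice.pickle (0, 0))); apply.
    by exists 0, 0.
  right; split.
  - by move=> _ [_ [_ [i [j [-> _ _]]]]]; exact: uA.
  - by exists (u 0), (u 1); split=> // /uI.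
  - by move=> _ _ _ [i [j [_ -> ->]]].
  - move=> _ _ [_ [_ [i [_ [-> _ _]]]]] [_ [_ [j [_ [-> _ _]]]]].
    by exists (u (choice.pickle (i, j))), i, j.
  - move=> x y x' y' z [i [j [-> -> ->]]] [i' [j' [-> -> /uI]]].
    by move/(pcan_inj choice.pickleK) => [-> ->].
set D := pairing_domain R in GR *.
have [le|le] := card_le_total (A `\` D) D.
  have [g [gD gI]] := pairing_graph_absorb GR le.
  have [DA _ _ _ _] := GR.
  apply: (card_le_fun (f := fun p => g p.1 p.2)).
    by move=> [x y] [/= Ax Ay]; apply: DA; apply: gD; right.
  move=> [x y] [x' y'] /set_mem[/= Ax Ay] /set_mem[/= Ax' Ay'] /gI.
  by case; [right|right|right|right|move=> E1 E2; rewrite E1 E2].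
have [phi phiA phiI] := card_le_funP t0 le.
have {}phiI x y : D x -> D y -> phi x = phi y -> x = y.
  by move=> Dx Dy; apply: phiI; exact: mem_set.
pose C := phi @` D.
have CD : C `&` D = set0.
  by apply/seteqP; split=> // _ [[x /phiA[_ nD] <-]].
have le' : C `\` D #<= D.
  apply: (card_le_trans _ (card_image_le phi D)).
  by apply: subset_card_le => x [].
have [g [gD gI]] := pairing_graph_absorb GR le'.
have [DA [a [b [Da Db ab]]] clos tot inj] := GR.
pose E := D `|` C.
pose R' := R `|` [set p : T * T * T | exists x y,
   [/\ E x, E y, ~ (D x /\ D y) & p = (x, y, phi (g x y))]].
have DR' x : pairing_domain R' x -> E x.
  by move=> [y [z [Rxyz|[x' [y' [Ex _ _ [-> _ _]]]]]]] //; left; exists y, z.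
have ER' x : E x -> pairing_domain R' x.
  move=> [[y [z Rxyz]]|Cx]; first by exists y, z; left.
  exists x, (phi (g x x)); right; exists x, x; split=> //; try by right.
  by move=> [Dx _]; suff : (C `&` D) x by rewrite CD.
exfalso; apply: (maxR R').
  split=> [p Rp|sub]; first by left.
  have Cp : C (phi a) by exists a.
  have : D (phi a).
    by have [y [z /sub R'p]] := ER' (phi a) (or_intror Cp); exists y, z.
  by move=> Dp; suff : (C `&` D) (phi a) by rewrite CD.
right; split.
- move=> x /DR'[/DA//|[y /phiA[Ay _] <-//]].
- by exists a, b; split=> //; apply: ER'; left.
- move=> x y z [/clos[Dy Dz]|[x' [y' [Ex Ey _ [_ -> ->]]]]].
    by split; apply: ER'; left.
  by split; apply: ER' => //; right; exists (g x' y') => //; exact: gD.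
- move=> x y /DR' Ex /DR' Ey.
  have [[Dx Dy]|nD] := pselect (D x /\ D y).
    by have [z Rz] := tot x y Dx Dy; exists z; left.
  by exists (phi (g x y)); right; exists x, y.
- have disj x y z x' y' : R (x, y, z) -> E x' -> E y' -> z = phi (g x' y') -> False.
    move=> /clos[_ Dz] Ex' Ey' zE; suff : (C `&` D) z by rewrite CD.
    by split=> //; exists (g x' y'); [exact: gD|].
  move=> x y x' y' z [Rz|[x1 [y1 [Ex1 Ey1 _ [-> -> E1]]]]]
      [Rz'|[x2 [y2 [Ex2 Ey2 _ [-> -> E2]]]]].
  + exact: inj Rz Rz'.
  + by case: (disj _ _ _ _ _ Rz Ex2 Ey2 E2).
  + by case: (disj _ _ _ _ _ Rz' Ex1 Ey1 E1).
  + by apply: gI => //; apply: phiI; [exact: gD|exact: gD|rewrite -E1].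
Qed.

Lemma card_le_setX T U V (A : set T) (B : set U) (C : set V) :
  infinite_set C -> A #<= C -> B #<= C -> A `*` B #<= C.
Proof.
move=> Cinf AC BC; have [c _] := infinite_setN0 Cinf.
have [f fC fI] := card_le_funP c AC; have [g gC gI] := card_le_funP c BC.
apply: card_le_trans (card_le_square Cinf).
apply: (card_le_fun (f := fun p => (f p.1, g p.2))).
  by move=> [x y] [/= /fC ? /gC].
move=> [x y] [x' y'] /set_mem[/= Ax By] /set_mem[/= Ax' By'] [E1 E2].
congr pair; first by apply: fI => //; exact: mem_set.
by apply: gI => //; exact: mem_set.
Qed.

Definition seqs T (A : set T) : set (seq T) :=
  [set s | forall i, (i < size s)%N -> forall x0, A (nth x0 s i)].

(** Iterated pairing separates sequences of equal length; the length is stored as well, as a point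
    of a countable subset of [A]. *)
Lemma card_le_seqs T (A : set T) : infinite_set A -> seqs A #<= A.
Proof.
move=> Ainf; have [a Aa] := infinite_setN0 Ainf.
have [u uA uI] := card_le_funP a ((infiniteP _).1 Ainf).
have [p0 p0A p0I] := card_le_funP a (card_le_square Ainf).
pose p x y := p0 (x, y).
have pA x y : A x -> A y -> A (p x y) by move=> Ax Ay; exact: p0A.
have pI x y x' y' : A x -> A y -> A x' -> A y' -> p x y = p x' y' ->
    x = x' /\ y = y'.
  move=> Ax Ay Ax' Ay' E; have [] // : (x, y) = (x', y').
  by apply: p0I => //; rewrite inE.
pose cd := foldr p a.
have seqs_cons x s : seqs A (x :: s) -> A x /\ seqs A s.
  by move=> H; split=> [|i Hi]; [exact: (H 0 erefl a)|exact: (H i.+1 Hi)].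
have cdA s : seqs A s -> A (cd s).
  by elim: s => //= x s IH /seqs_cons[Ax /IH]; exact: pA.
have cdI s s' : seqs A s -> seqs A s' -> size s = size s' -> cd s = cd s' -> s = s'.
  elim: s s' => [|x s IH] [|x' s'] // /seqs_cons[Ax As].
  move=> /seqs_cons[Ax' As'] [Es] /=.
  by move=> /pI[|||//|-> /IH ->] //; exact: cdA.
apply: (card_le_fun (f := fun s => p (u (size s)) (cd s))).
  by move=> s As; apply: pA; [exact: uA|exact: cdA].
move=> s s' /set_mem As /set_mem As' /pI[||||E1 E2]; try exact: cdA; try exact: uA.
by apply: cdI => //; apply: uI => //; exact: mem_set.
Qed.

Lemma infinite_continuum : infinite_set continuum.
Proof.
apply/infiniteP; apply: (card_le_fun (f := fun n _ => n)) => // m n _ _.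
by move/(congr1 (fun g => g 0)).
Qed.

(** Embed the square of c into the union. If every row has a point that lands in [A], choosing one
    per row embeds c in [A]; otherwise some row lies entirely in [B]. *)
Lemma continuum_setU T (A B : set T) :
  continuum #<= A `|` B -> (continuum #<= A) \/ (continuum #<= B).
Proof.
move=> /(card_le_trans (card_le_square infinite_continuum)) le.
have [t0 _] : (A `|` B) !=set0.
  apply/set0P/eqP => AB0; move: le; rewrite AB0 => /card_le0P /seteqP[sub _].
  exact: (sub (id, id)).
have [f fAB fI] := card_le_funP t0 le.
have {}fI : injective f by move=> p q; apply: fI; exact: mem_set.
have [tA|/existsNP[x nx]] := pselect (forall x, exists y, A (f (x, y))).
  have [g gA] := choice tA.
  by left; apply: (card_le_fun (f := fun x => f (x, g x))) => // x y _ _ /fI[].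
right; apply: (card_le_fun (f := fun y => f (x, y))) => [y _|y z _ _ /fI[]//].
by have [//|Axy|] := fAB (x, y); [case: nx; exists y|].
Qed.

(** Start from any well-order. If some initial segment has size c, let [t] be the least point
    bounding such a segment, and pull the order back along an injection of all functions into the
    segment below [t]. *)
Lemma continuum_well_order : exists lt : (nat -> nat) -> (nat -> nat) -> Prop,
  [/\ well_founded lt, forall x y z, lt x y -> lt y z -> lt x z,
      forall x y, [\/ lt x y, x = y | lt y x] &
      forall y, ~ (continuum #<= [set x | lt x y])].
Proof.
have [R Rwo] := well_ordering_principle (nat -> nat : eqType).
have min (A : set (nat -> nat)) : A !=set0 -> exists2 z, A z & forall x, A x -> R z x.
  move=> [a Aa]; have [|z [[Az zmin] _]] := Rwo (mem A); first by exists a; exact: mem_set.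
  by exists z => [|x Ax]; [exact: set_mem|apply: zmin; exact: mem_set].
have Rxx x : R x x by have [|z -> /(_ x erefl)] := min [set x]; first by exists x.
have tot x y : R x y \/ R y x.
  have [|z [->|->] zm] := min [set x; y]; first by exists x; left.
    by left; apply: zm; right.
  by right; apply: zm; left.
have anti x y : R x y -> R y x -> x = y.
  move=> xy yx; have [|z [_ zu]] := Rwo (mem [set x; y]).
    by exists x; apply: mem_set; left.
  rewrite -(zu x) ?(zu y) //; split; try by apply: mem_set; [left|right].
  - by apply: mem_set; right.
  - by move=> w /set_mem[] ->.
  - by apply: mem_set; left.
  - by move=> w /set_mem[] ->.
have tr x y z : R x y -> R y z -> R x z.
  move=> xy yz; have [|w [[->|->]|->] wm] := min [set x; y; z].
  - by exists x; left; left.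
  - by apply: wm; right.
  - have -> : x = y by apply: anti => //; apply: wm; left; left.
    by [].
  - have zy : z = y by apply: anti => //; apply: wm; left; right.
    by rewrite zy.
pose lt x y := R x y /\ x <> y.
have lttr x y z : lt x y -> lt y z -> lt x z.
  move=> [xy nxy] [yz nyz]; split; first exact: tr yz.
  by move=> xz; apply: nxy; apply: anti => //; rewrite xz.
have lttri x y : [\/ lt x y, x = y | lt y x].
  have [->|nxy] := pselect (x = y); first by constructor 2.
  by case: (tot x y) => ?; [constructor 1|constructor 3]; split=> // /esym.
have ltwf : well_founded lt.
  move=> x; apply: contrapT => nx.
  have [|z nz zmin] := min [set x | ~ Acc lt x]; first by exists x.
  apply: nz; constructor => y [yz nyz]; apply: contrapT => ny.
  by apply: nyz; apply: anti => //; exact: zmin.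
have pull (rho : (nat -> nat) -> (nat -> nat)) : injective rho ->
    (forall y, ~ (continuum #<= [set x | lt x (rho y)])) ->
  exists lt : (nat -> nat) -> (nat -> nat) -> Prop,
    [/\ well_founded lt, forall x y z, lt x y -> lt y z -> lt x z,
        forall x y, [\/ lt x y, x = y | lt y x] &
        forall y, ~ (continuum #<= [set x | lt x y])].
  move=> rhoI small; exists (fun x y => lt (rho x) (rho y)); split.
  - exact: wf_inverse_image.
  - by move=> x y z; exact: lttr.
  - move=> x y; case: (lttri (rho x) (rho y)); [by constructor 1| |by constructor 3].
    by move=> /rhoI ->; constructor 2.
  - move=> y le; apply: (small y); apply: card_le_trans le _.
    by apply: (card_le_fun (f := rho)) => // a b _ _; exact: rhoI.
have [big|nbig] := pselect (exists t, continuum #<= [set x | lt x t]); last first.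
  by apply: (pull id) => // y le; apply: nbig; exists y.
have [t /(card_le_funP point)[rho rhot rhoI] tmin] := min _ big.
apply: (pull rho) => [x y|y le].
  by apply: rhoI; exact: mem_set.
have [yt] := rhot y I; apply; apply: anti => //.
exact: tmin.
Qed.

(** * Matching and conditions *)

(** The code of [t] lists, for each [n], [n.+1] points of [G t] with distinct abscissas. Fewer than
    c codes cannot form an [mc_family], so one [gamma] agrees with every code somewhere. Each guess
    made by [gamma] then contributes at most one point to [g]. *)
Lemma simultaneous_matching T (K : set T) (G : T -> set (nat * nat)) :
    (forall H, mc_family H -> continuum #<= H) -> ~ (continuum #<= K) ->
    (forall t, K t -> forall L : seq nat, exists2 p, G t p & p.1 \notin L) ->
  exists g : nat -> nat, forall t, K t -> exists v, G t (v, g v).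
Proof.
move=> mcC Ksmall Ginf.
have /choice[phi phiP] : forall tn : T * nat, exists l : seq (nat * nat),
    K tn.1 -> [/\ size l = tn.2.+1, uniq (map fst l) &
                  forall p, p \in l -> G tn.1 p].
  move=> [t n] /=; have [Kt|] := pselect (K t); last by exists [::].
  elim: n => [|n [l lP]].
    have [p Gp _] := Ginf t Kt [::].
    by exists [:: p] => _; split=> // q; rewrite inE => /eqP ->.
  have [sl ul Gl] := lP Kt; have [p Gp pl] := Ginf t Kt (map fst l).
  exists (p :: l) => _; split=> [/=|/=|q]; [by rewrite sl|by rewrite pl|].
  by rewrite inE => /predU1P[->//|/Gl].
pose code t : nat -> nat := fun n => choice.pickle (phi (t, n)).
have /existsNP[gamma gammaN] : ~ mc_family (code @` K).
  by move=> /mcC le; apply: Ksmall; exact: card_le_trans le (card_image_le _ _).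
have gammaP t : K t -> exists n, gamma n = code t n.
  move=> Kt; apply: contrapT => H; apply: gammaN; exists (code t); first by exists t.
  by move=> n E; apply: H; exists n.
pose guess n : seq (nat * nat) := odflt [::] (choice.unpickle (gamma n)).
pose fresh n (U : seq (nat * nat)) := [seq p <- guess n | p.1 \notin map fst U].
(* U n is the part of the matching function decided by the first n guesses;
   as it has at most n points, a guess of n.+1 points offers a fresh one. *)
pose U := fix U n := if n is m.+1 then
  (if fresh m (U m) is p :: _ then p :: U m else U m) else [::].
have Usz n : (size (U n) <= n)%N.
  elim: n => //= n IH; case: (fresh n (U n)) => [|p s] //=.
  exact: leq_trans IH (leqnSn _).
have Uuniq n : uniq (map fst (U n)).
  elim: n => //= n IH; case E : (fresh n (U n)) => [|p s] //=.
  rewrite IH andbT; have : p \in fresh n (U n) by rewrite E mem_head.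
  by rewrite mem_filter => /andP[].
have Usub m n : (m <= n)%N -> {subset U m <= U n}.
  move=> /subnK <-; elim: (n - m)%N => // k IH p /IH {}IH.
  rewrite addSn /=; case: (fresh _ _) => // q s; rewrite inE IH; exact: orbT.
have Ufun m n v y z : (v, y) \in U m -> (v, z) \in U n -> y = z.
  wlog mn : m n y z / (m <= n)%N.
    move=> W yU zU; have [mn|/ltnW nm] := leqP m n; first exact: W mn yU zU.
    exact/esym/(W _ _ _ _ nm zU yU).
  move=> /(Usub _ _ mn) yU zU; move: (Uuniq n) yU zU; elim: (U n) => //= -[a b] s IH.
  move=> /andP[/= as_ us]; rewrite !inE !xpair_eqE.
  have notin c : v = a -> (v, c) \in s -> False.
    by move=> va vc; move: as_; rewrite -va; move/negP; apply; exact: (map_f fst vc).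
  move=> /orP[/andP[/eqP va /eqP ->]|yU] /orP[/andP[/eqP va' /eqP ->]|zU] //.
  - by case: (notin z).
  - by case: (notin y).
  - exact: IH.
have /choice[g gP] : forall v, exists y, forall n z, (v, z) \in U n -> y = z.
  move=> v; have [[y [n yU]]|no] := pselect (exists y n, (v, y) \in U n).
    by exists y => m z; exact: Ufun yU.
  by exists 0 => n z zU; case: no; exists z, n.
exists g => t Kt; have [n En] := gammaP t Kt; have [sz uq GG] := phiP (t, n) Kt.
have Eg : guess n = phi (t, n) by rewrite /guess En /code choice.pickleK.
(* Pigeonhole: the guess has [n.+1] distinct abscissas, and [U n] uses at most [n]. *)
have : fresh n (U n) != [::].
  apply/eqP => E0; have sub : {subset map fst (phi (t, n)) <= map fst (U n)}.
    move=> v /mapP[p pphi ->]; apply: contraT => pU.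
    have : p \in fresh n (U n) by rewrite mem_filter pU Eg.
    by rewrite E0.
  have := uniq_leq_size uq sub; rewrite !size_map sz /= => le.
  by have := leq_ltn_trans (Usz n) le; rewrite ltnn.
case E : (fresh n (U n)) => [//|[v y] s] _.
have : (v, y) \in fresh n (U n) by rewrite E mem_head.
rewrite mem_filter Eg => /andP[_ vyphi].
have vyU : (v, y) \in U n.+1 by rewrite /= E mem_head.
by exists v; rewrite (gP v _ _ vyU); exact: GG.
Qed.

(* A pair (P, N) of lists stands for the function h of FF(I) with value 0 on P
   and 1 on N. *)
Definition condition := (seq (set nat) * seq (set nat))%type.

Definition condition_on (I : set (set nat)) (p : condition) : Prop :=
  [/\ forall A, A \in p.1 -> I A, forall A, A \in p.2 -> I A &
      forall A, A \in p.1 -> A \in p.2 -> False].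

Definition ccell (p : condition) : set nat :=
  [set x | (forall A, A \in p.1 -> A x) /\ (forall A, A \in p.2 -> ~ A x)].

Definition cle (p q : condition) : Prop :=
  {subset p.1 <= q.1} /\ {subset p.2 <= q.2}.

Definition represents (p : condition) (h : {fmap set nat -> bool}) : Prop :=
  forall A b, h.[? A] = Some b <-> A \in (if b then p.2 else p.1).

Lemma represents_cell p h : represents p h -> cell h = ccell p.
Proof.
move=> ph; apply/seteqP; split=> x.
  move=> hx; split=> A Ap.
    by have := hx (A, false); apply; apply/ph.
  by have := hx (A, true); apply; apply/ph.
by move=> [x1 x2] [A [] /= /ph]; [exact: x2|exact: x1].
Qed.

Lemma represents_FF I p h : represents p h -> (FF I h <-> condition_on I p).
Proof.
move=> ph; split=> [hI|[p1 p2 _] A /=].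
  split=> A.
  - by move=> /(ph A false) hA; apply: hI => /=; rewrite -fndSome hA.
  - by move=> /(ph A true) hA; apply: hI => /=; rewrite -fndSome hA.
  - by move=> /(ph A false) hA /(ph A true); rewrite hA.
rewrite -fndSome; case hA : h.[? A] => [b|//] _.
by case: b hA => /ph; [exact: p2|exact: p1].
Qed.

Lemma represents_extends p q h k : represents p h -> represents q k ->
  (fmap_extends h k <-> cle p q).
Proof.
move=> ph qk; split=> [hk|[s1 s2] A [] /ph]; last 2 first.
- by move=> /s2 Aq; apply/qk.
- by move=> /s1 Aq; apply/qk.
by split=> A; [move=> /(ph A false)|move=> /(ph A true)] => /hk /qk.
Qed.

Lemma condition_represents I p : condition_on I p -> exists h, represents p h.
Proof.
move=> [_ _ disj].
exists [fmap A : seq_fset tt (p.1 ++ p.2) => \val A \in p.2] => A b.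
have [Ap|nAp] := boolP (A \in seq_fset tt (p.1 ++ p.2)).
  rewrite (in_fnd Ap) ffunE /=.
  move: Ap; rewrite seq_fsetE mem_cat; have [A2 _|nA2] := boolP (A \in p.2).
    by case: b; split=> // /disj /(_ A2).
  by rewrite orbF => A1; case: b; split=> //; rewrite (negbTE nA2).
rewrite not_fnd //; move: nAp; rewrite seq_fsetE mem_cat negb_or => /andP[n1 n2].
by case: b; split=> //; [rewrite (negbTE n2)|rewrite (negbTE n1)].
Qed.

Lemma FF_represented (h : {fmap set nat -> bool}) : exists p, represents p h.
Proof.
exists ([seq A <- domf h | h.[? A] == Some false],
        [seq A <- domf h | h.[? A] == Some true]) => A b.
have -> : (if b then [seq A <- domf h | h.[? A] == Some true]
           else [seq A <- domf h | h.[? A] == Some false]) =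
          [seq A <- domf h | h.[? A] == Some b] by case: b.
rewrite mem_filter; split=> [hA|/andP[/eqP]//].
by rewrite hA eqxx /= -fndSome hA.
Qed.

Definition cindependent (I : set (set nat)) : Prop :=
  forall p, condition_on I p -> ccell p !=set0.

Lemma independent_familyP I :
  independent_family I <-> infinite_set I /\ cindependent I.
Proof.
split=> -[Iinf H]; split=> //.
  move=> p pI; have [h ph] := condition_represents pI.
  by rewrite -(represents_cell ph); apply: H; apply/(represents_FF I ph).
move=> h hI; have [p ph] := FF_represented h.
by rewrite (represents_cell ph); apply: H; apply/(represents_FF I ph).
Qed.

Lemma everywhere_selectiveP I : everywhere_selective I <->
  forall (f : nat -> nat) p, condition_on I p -> exists q,
    [/\ condition_on I q, cle p q &
        set_inj (ccell q) f \/ constant_on (ccell q) f].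
Proof.
split=> H f p pI.
  have [h ph] := condition_represents pI.
  have [k [kI hk fk]] := H f h ((represents_FF I ph).2 pI).
  have [q qk] := FF_represented k; exists q; split.
  - exact/(represents_FF I qk).
  - exact/(represents_extends ph qk).
  - by rewrite -(represents_cell qk).
have [q qp] := FF_represented p.
have [r [rI qr fr]] := H f q ((represents_FF I qp).1 pI).
have [k rk] := condition_represents rI; exists k; split.
- exact/(represents_FF I rk).
- exact/(represents_extends qp rk).
- by rewrite (represents_cell rk).
Qed.

Lemma selectiveP I : selective I <->
  forall f : nat -> nat, exists2 q, condition_on I q &
    set_inj (ccell q) f \/ constant_on (ccell q) f.
Proof.
split=> H f.
  have [_ [h hI <-] fh] := H f; have [q qh] := FF_represented h.
  exists q; first exact/(represents_FF I qh).
  by rewrite -(represents_cell qh).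
have [q qI fq] := H f; have [h qh] := condition_represents qI.
exists (ccell q) => //; exists h; last exact: represents_cell.
exact/(represents_FF I qh).
Qed.

(** * Adding one set *)

Lemma infinite_set_notin (T : eqType) (I : set T) (L : seq T) :
  infinite_set I -> exists2 A, I A & A \notin L.
Proof.
move=> Iinf; apply: contrapT => H; apply: Iinf.
apply: (@sub_finite_set _ _ [set` L]) (finite_seq L) => A IA /=.
by apply: contrapT => /negP AL; apply: H; exists A.
Qed.

Lemma cle_refl p : cle p p. Proof. by split. Qed.

Lemma cle_trans p q r : cle p q -> cle q r -> cle p r.
Proof. by move=> [s1 s2] [t1 t2]; split=> A; [move/s1/t1|move/s2/t2]. Qed.

Lemma ccell_cle p q : cle p q -> ccell q `<=` ccell p.
Proof. by move=> [s1 s2] x [x1 x2]; split=> A; [move/s1/x1|move/s2/x2]. Qed.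

Lemma condition_onS I J p : I `<=` J -> condition_on I p -> condition_on J p.
Proof. by move=> IJ [p1 p2 d]; split=> // A; [move/p1/IJ|move/p2/IJ]. Qed.

Definition cmerge (p q : condition) : condition := (p.1 ++ q.1, p.2 ++ q.2).

Lemma ccell_cmerge p q : ccell (cmerge p q) = ccell p `&` ccell q.
Proof.
apply/seteqP; split=> x.
  by move=> [x1 x2]; split; split=> A Ap; [apply: x1|apply: x2|apply: x1|apply: x2];
    rewrite mem_cat Ap ?orbT.
by move=> [[x1 x2] [y1 y2]]; split=> A /=; rewrite mem_cat => /orP[];
  [exact: x1|exact: y1|exact: x2|exact: y2].
Qed.

Lemma cle_cmergel p q : cle p (cmerge p q).
Proof. by split=> A Ap; rewrite mem_cat Ap. Qed.

Lemma condition_cmerge I p q : condition_on I p -> condition_on I q ->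
  condition_on I (cmerge p q) \/ ccell p `&` ccell q = set0.
Proof.
move=> [p1 p2 pd] [q1 q2 qd].
have [[A [A1 A2]]|d] := pselect (exists A, A \in (cmerge p q).1 /\
                                          A \in (cmerge p q).2).
  right; rewrite -ccell_cmerge; apply/seteqP; split=> // x [x1 x2].
  exact: x2 A2 (x1 _ A1).
left; split=> A /=; last by move=> A1 A2; apply: d; exists A.
- by rewrite mem_cat => /orP[/p1|/q1].
- by rewrite mem_cat => /orP[/p2|/q2].
Qed.

(** To avoid a further point [y], add to [p] a set of [I] not yet mentioned, with the sign that
    excludes [y]. *)
Lemma ccell_infinite I p (L : seq nat) : infinite_set I -> cindependent I ->
  condition_on I p -> exists2 x, ccell p x & x \notin L.
Proof.
move=> Iinf Iind; elim: L p => [|y L IH] p pI.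
  by have [x px] := Iind p pI; exists x.
have [A IA] := infinite_set_notin (p.1 ++ p.2) Iinf.
rewrite mem_cat negb_or => /andP[nA1 nA2]; have [p1 p2 pd] := pI.
have [Ay|nAy] := pselect (A y).
  have [|x px xL] := IH (p.1, A :: p.2).
    split=> //= B; first by rewrite inE => /predU1P[->|/p2].
    move=> B1; rewrite inE => /predU1P[E|]; last exact: pd.
    by move: nA1; rewrite -E B1.
  exists x; first by apply: ccell_cle px; split=> // B Bp; rewrite /= inE Bp orbT.
  rewrite inE negb_or xL andbT; apply/eqP => xy.
  by have [_ /(_ A)] := px; apply; [rewrite mem_head|rewrite xy].
have [|x px xL] := IH (A :: p.1, p.2).
  split=> //= B; first by rewrite inE => /predU1P[->|/p1].
  by rewrite inE => /predU1P[->|]; [move: nA2 => /negP|exact: pd].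
exists x; first by apply: ccell_cle px; split=> // B Bp; rewrite /= inE Bp orbT.
rewrite inE negb_or xL andbT; apply/eqP => xy; apply: nAy.
by have [/(_ A) + _] := px; rewrite -xy; apply; exact: mem_head.
Qed.

Lemma card_conditions I : infinite_set I -> [set p | condition_on I p] #<= I.
Proof.
move=> Iinf; have sI := card_le_seqs Iinf.
apply: card_le_trans (card_le_setX Iinf sI sI).
apply: subset_card_le => p [p1 p2 _]; split=> i i_lt x0; [apply: p1|apply: p2];
  exact: mem_nth.
Qed.

Definition splits (S : set nat) (B : set nat) : Prop :=
  (exists2 x, B x & S x) /\ (exists2 x, B x & ~ S x).

Section Extension.

Hypothesis mcC : forall H, mc_family H -> continuum #<= H.
Variable I : set (set nat).
Hypotheses (Iinf : infinite_set I) (Iind : cindependent I).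
Hypothesis Ismall : ~ (continuum #<= I).

Lemma exists_splitting :
  exists J : set nat, forall p, condition_on I p -> splits J (ccell p).
Proof.
(* A condition with a bit asks for a point of the cell at which [g] has that bit as value; there are
   fewer than c such requests. *)
pose G (t : condition * bool) : set (nat * nat) :=
  [set q | ccell t.1 q.1 /\ q.2 = nat_of_bool t.2].
have [||g gP] := @simultaneous_matching _
    ([set p | condition_on I p] `*` [set: bool]) G mcC.
- move=> le; apply: Ismall; apply: card_le_trans le _; apply: card_le_setX => //.
    exact: card_conditions.
  have /infiniteP := Iinf; apply: card_le_trans.
  by apply: (card_le_fun (f := fun b : bool => b : nat)) => // -[] [].
- move=> [p b] [/= pI _] L; have [x px xL] := ccell_infinite L Iinf Iind pI.
  by exists (x, b : nat).
exists [set x | g x = 1] => p pI; split.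
  by have [|v [pv gv]] := gP (p, true); [|exists v].
by have [|v [pv gv]] := gP (p, false); [|exists v => //=; rewrite /= in gv; rewrite gv].
Qed.

(* Inside ccell p the new set is S; outside it is an arbitrary set splitting
   all cells, which keeps the family independent. *)
Lemma splitting_extension p S : condition_on I p ->
    (forall q, condition_on I q -> cle p q -> splits S (ccell q)) ->
  exists A, [/\ cindependent (I `|` [set A]), condition_on (I `|` [set A]) (A :: p.1, p.2)
              & ccell (A :: p.1, p.2) `<=` S `&` ccell p].
Proof.
move=> pI Ssplit; have [J JP] := exists_splitting.
pose A : set nat := [set x | if pselect (ccell p x) is left _ then S x else J x].
have Ain x : ccell p x -> A x <-> S x by rewrite /A /=; case: pselect.
have Aout x : ~ ccell p x -> A x <-> J x by rewrite /A /=; case: pselect.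
have Asplit q : condition_on I q -> splits A (ccell q).
  move=> qI; have [mI|disj] := condition_cmerge pI qI.
    have [[x + Sx] [y + nSy]] := Ssplit _ mI (@cle_cmergel p q).
    rewrite !ccell_cmerge => -[px qx] [py qy].
    by split; [exists x => //; exact/Ain|exists y => // /(Ain _ py)].
  have out x : ccell q x -> ~ ccell p x.
    by move=> qx px; suff : (ccell p `&` ccell q) x by rewrite disj.
  have [[x qx Jx] [y qy nJy]] := JP q qI; split.
    by exists x => //; apply/Aout => //; exact: out.
  by exists y => // /(Aout _ (out _ qy)).
have [p1 p2 pd] := pI.
(* [S] meets [ccell p], hence so does [A], which therefore is not among the sets excluded by [p]. *)
have nAp : A \in p.2 -> False.
  move=> A2; have [[x px Sx] _] := Ssplit p pI (@cle_refl p).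
  by have [_ /(_ A A2)] := px; apply; exact/Ain.
exists A; split.
- move=> q [q1 q2 qd].
  (* Delete [A] from [q]: what remains is a condition over [I], and [A] splits its cell, so a point
     with either sign is available. *)
  pose r : condition := ([seq B <- q.1 | B != A], [seq B <- q.2 | B != A]).
  have rI : condition_on I r.
    split=> B; rewrite !mem_filter.
    - by move=> /andP[/eqP nBA /q1[]].
    - by move=> /andP[/eqP nBA /q2[]].
    - by move=> /andP[_ B1] /andP[_]; exact: qd.
  have rq x : ccell r x -> (A \in q.1 -> A x) -> (A \in q.2 -> ~ A x) -> ccell q x.
    move=> [r1 r2] x1 x2; split=> B Bq; have [E|nE] := eqVneq B A.
    + by rewrite E; apply: x1; rewrite -E.
    + by apply: r1; rewrite mem_filter nE.
    + by rewrite E; apply: x2; rewrite -E.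
    + by apply: r2; rewrite mem_filter nE.
  have [[x rx Ax] [y ry nAy]] := Asplit r rI.
  have [A1|nA1] := boolP (A \in q.1).
    by exists x; apply: rq => // /(qd _ A1).
  by exists y; apply: rq => // A1; move: nA1; rewrite A1.
- split=> B /=.
  + by rewrite inE => /predU1P[->|/p1 IB]; [right|left].
  + by move=> /p2 IB; left.
  + by rewrite inE => /predU1P[->|/pd].
- move=> x [x1 x2]; have px : ccell p x.
    by split=> // B Bp; apply: x1; rewrite inE Bp orbT.
  by split=> //; apply/(Ain _ px); apply: x1; exact: mem_head.
Qed.

Lemma selective_extension (f : nat -> nat) p : condition_on I p ->
  exists A q, [/\ cindependent (I `|` [set A]), condition_on (I `|` [set A]) q,
    cle p q & set_inj (ccell q) f \/ constant_on (ccell q) f].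
Proof.
move=> pI.
have [[q [qI pq fq]]|none] := pselect (exists q, [/\ condition_on I q, cle p q &
    set_inj (ccell q) f \/ constant_on (ccell q) f]).
  have [A IA] := infinite_setN0 Iinf; exists A, q.
  have -> : I `|` [set A] = I.
    by apply/seteqP; split=> B; [move=> [|->]|left].
  by split.
have extend q S : condition_on I q -> cle p q ->
    (forall r, condition_on I r -> cle q r -> splits S (ccell r)) ->
    set_inj S f \/ constant_on S f ->
    exists A q, [/\ cindependent (I `|` [set A]), condition_on (I `|` [set A]) q,
      cle p q & set_inj (ccell q) f \/ constant_on (ccell q) f].
  move=> qI pq Ssplit fS; have [A [Aind AI sub]] := splitting_extension qI Ssplit.
  exists A, (A :: q.1, q.2); split=> //.
    by apply: cle_trans pq _; split=> // B Bq; rewrite inE Bq orbT.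
  case: fS => [injS|[c cS]]; [left|right; exists c => x /sub[/cS]//].
  move=> x y /set_mem /sub[Sx _] /set_mem /sub[Sy _].
  by apply: injS; exact: mem_set.
(* A fiber of [f] that meets every cell below [q] splits them all: by [none], [f] is constant on no
   cell below [p]. *)
have [[q [qI pq [c cq]]]|nconst] := pselect (exists q, [/\ condition_on I q, cle p q &
    exists c, forall r, condition_on I r -> cle q r ->
      exists2 x, ccell r x & f x = c]).
  apply: (extend q [set x | f x = c]) => //; last by right; exists c.
  move=> r rI qr; split; first exact: cq.
  apply: contrapT => H; apply: none; exists r; split=> //; first exact: cle_trans qr.
  by right; exists c => x rx; apply: contrapT => fx; apply: H; exists x.
(* Any value can be avoided by passing to a smaller cell, so [f] takes infinitely many values on
   every cell below [p]. *)
have finf q (L : seq nat) : condition_on I q -> cle p q ->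
    exists2 x, ccell q x & f x \notin L.
  elim: L q => [|c L IH] q qI pq; first by have [x] := Iind qI; exists x.
  have : ~ forall r, condition_on I r -> cle q r -> exists2 x, ccell r x & f x = c.
    by move=> H; apply: nconst; exists q; split=> //; exists c.
  move=> /existsNP[r /not_implyP[rI /not_implyP[qr nr]]].
  have [x rx xL] := IH r rI (cle_trans pq qr); exists x; first exact: ccell_cle rx.
  by rewrite inE negb_or xL andbT; apply/eqP => fx; apply: nr; exists x.
(* Match the inverse relations of [f] on these cells: the set of [x] with [g (f x) = x] then meets
   every cell below [p], and [f] is one-to-one on it. *)
have [||g gP] := @simultaneous_matching _ [set q | condition_on I q /\ cle p q]
    (fun q => [set u | ccell q u.2 /\ f u.2 = u.1]) mcC.
- move=> le; apply: Ismall; apply: card_le_trans le _.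
  apply: card_le_trans (card_conditions Iinf).
  by apply: subset_card_le => q [].
- move=> q [qI pq] L; have [x qx fx] := finf q L qI pq.
  by exists (f x, x).
apply: (extend p [set x | g (f x) = x] pI (@cle_refl p)); last first.
  by left=> x y /set_mem /= gx /set_mem /= gy E; rewrite -gx -gy E.
move=> r rI pr; split.
  by have [v [rv fv]] := gP r (conj rI pr); exists (g v) => //=; rewrite /= in fv; rewrite fv.
(* On a cell contained in this set, [g] would be a left inverse of [f], making [f] one-to-one there,
   against [none]. *)
apply: contrapT => H; apply: none; exists r; split=> //; left.
have gr x : ccell r x -> g (f x) = x.
  by move=> rx; apply: contrapT => gx; apply: H; exists x.
by move=> x y /set_mem /gr {2}<- /set_mem /gr {2}<- ->.
Qed.

End Extension.

(** * Recursion of length c *)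

Lemma card_set_nat : [set: set nat] #<= continuum.
Proof.
apply: (card_le_fun (f := fun A n => nat_of_bool `[< A n >])) => // A B _ _ E.
apply/seteqP; split=> n; move: (congr1 (fun g => g n) E) => /=;
  by case: asboolP; case: asboolP.
Qed.

Lemma card_all_conditions : [set: condition] #<= continuum.
Proof.
have sC : [set: seq (set nat)] #<= continuum.
  have inf : infinite_set [set: set nat].
    apply/infiniteP; apply: (card_le_fun (f := fun n => [set n])) => // m n _ _.
    by move/seteqP => [/(_ m erefl)].
  apply: card_le_trans card_set_nat; apply: card_le_trans (card_le_seqs inf).
  exact: subset_card_le.
apply: card_le_trans (card_le_setX infinite_continuum sC sC).
exact: subset_card_le.
Qed.

(** Each task must recur c times, so that it still occurs after any given stage. The map [pi]
    inverts an injection into c of the product of [T] and c. *)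
Lemma continuum_repetition T : [set: T] #<= continuum -> T ->
  exists pi : (nat -> nat) -> T, forall t, continuum #<= [set w | pi w = t].
Proof.
move=> TC t0.
have := card_le_setX infinite_continuum TC (card_lexx continuum).
move=> /(card_le_funP id)[j _ jI].
have {}jI : injective j by move=> p q; apply: jI; exact: mem_set.
have /choice[pi piP] : forall w, exists t, forall t' z, j (t', z) = w -> t' = t.
  move=> w; have [[t [z E]]|no] := pselect (exists t z, j (t, z) = w).
    by exists t => t' z' E'; have [] : (t', z') = (t, z) by apply: jI; rewrite E.
  by exists t0 => t z E; case: no; exists t, z.
exists pi => t; apply: (card_le_fun (f := fun z => j (t, z))) => [z _|z z' _ _].
  by rewrite /= -(piP _ t z).
by move/jI => [].
Qed.

(** [A t] is the set added at stage [t] for the task [pi t], and [J t] consists of [I] and the sets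
    added before. Initial segments are smaller than c, so [J t] is too, and one more set can be
    added at every stage. *)
Lemma exists_everywhere_selective I :
    (forall H, mc_family H -> continuum #<= H) ->
    infinite_set I -> cindependent I -> ~ (continuum #<= I) ->
  exists I', [/\ independent_family I', everywhere_selective I' & I `<=` I'].
Proof.
move=> mcC Iinf Iind Ismall.
have [lt [ltwf lttr lttri ltsmall]] := continuum_well_order.
pose task := ((nat -> nat) * condition)%type.
have [pi piP] : exists pi : (nat -> nat) -> task,
    forall t, continuum #<= [set w | pi w = t].
  apply: continuum_repetition (id, ([::], [::])).
  apply: card_le_trans (card_le_setX infinite_continuum
    (card_lexx continuum) card_all_conditions).
  exact: subset_card_le.
pose solved (J : set (set nat)) (f : nat -> nat) p := exists q,
  [/\ condition_on J q, cle p q & set_inj (ccell q) f \/ constant_on (ccell q) f].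
have /choice[step stepP] : forall x : set (set nat) * task, exists A,
    infinite_set x.1 -> cindependent x.1 -> ~ (continuum #<= x.1) ->
    cindependent (x.1 `|` [set A]) /\
    (condition_on x.1 x.2.2 -> solved (x.1 `|` [set A]) x.2.1 x.2.2).
  move=> [J [f p]] /=.
  have [[Jinf [Jind Jsmall]]|nJ] :=
      pselect (infinite_set J /\ cindependent J /\ ~ (continuum #<= J)); last first.
    by exists set0 => ? ? ?; case: nJ.
  have [pJ|npJ] := pselect (condition_on J p).
    have [A [q [Aind qI pq fq]]] := selective_extension mcC Jinf Jind Jsmall f pJ.
    by exists A => _ _ _; split=> // _; exists q.
  (* The condition of the task is not over [J]; the empty condition still provides a set that
     preserves independence. *)
  have [|A [_ [Aind _ _ _]]] :=
    selective_extension mcC Jinf Jind Jsmall f (p := ([::], [::])); first by split.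
  by exists A.
pose F t (rec : forall s, lt s t -> set nat) : set nat :=
  step (I `|` [set B | exists s (l : lt s t), B = rec s l], pi t).
pose A := Fix ltwf (fun=> set nat) F.
pose J t := I `|` A @` [set s | lt s t].
have AE t : A t = step (J t, pi t).
  rewrite /A Fix_eq.
    rewrite {1}/F; congr (step (I `|` _, _)); apply/seteqP; split=> B.
      by move=> [s [l ->]]; exists s.
    by move=> [s l <-]; exists s, l.
  by move=> t' g g' gg'; congr F; apply: functional_extensionality_dep => s;
    apply: functional_extensionality_dep => l; exact: gg'.
have IJ t : I `<=` J t by left.
have Jinf t : infinite_set (J t) by exact: sub_infinite_set (IJ t) Iinf.
have Jsmall t : ~ (continuum #<= J t).
  move=> /continuum_setU[//|le]; apply: (ltsmall t).
  exact: card_le_trans le (card_image_le _ _).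
have Jlt s t : lt s t -> J s `|` [set A s] `<=` J t.
  move=> st B [[IB|[r rs <-]]|->]; [by left| |by right; exists s].
  by right; exists r => //; exact: lttr st.
(* Stages increase, so finitely many members of the union lie together in [I] or in a single stage;
   this carries independence through limits. *)
have directed (D : set (nat -> nat)) (L : seq (set nat)) :
    (forall B, B \in L -> (I `|` A @` D) B) ->
    (forall B, B \in L -> I B) \/
    exists2 s, D s & forall B, B \in L -> (J s `|` [set A s]) B.
  elim: L => [|B L IH] LD; first by left.
  have {}IH : (forall B, B \in L -> I B) \/
      exists2 s, D s & forall B, B \in L -> (J s `|` [set A s]) B.
    by apply: IH => C CL; apply: LD; rewrite inE CL orbT.
  have [IB|[t Dt tB]] := LD B (mem_head _ _).
    case: IH => [IL|[s Ds sL]]; [left|right].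
      by move=> C; rewrite inE => /predU1P[->|/IL].
    exists s => // C; rewrite inE => /predU1P[->|/sL//].
    by left; exact: IJ.
  right; case: IH => [IL|[s Ds sL]].
    exists t => // C; rewrite inE => /predU1P[->|/IL IC]; first by right.
    by left; exact: IJ.
  case: (lttri s t) => [st|st|ts].
  - exists t => // C; rewrite inE => /predU1P[->|/sL/(Jlt _ _ st)]; first by right.
    by left.
  - exists t => // C; rewrite inE => /predU1P[->|/sL]; first by right.
    by rewrite st.
  - exists s => // C; rewrite inE => /predU1P[->|/sL//].
    by left; apply: Jlt ts _ _; right.
have cond_dir (D : set (nat -> nat)) p : condition_on (I `|` A @` D) p ->
    condition_on I p \/ exists2 s, D s & condition_on (J s `|` [set A s]) p.
  move=> [p1 p2 pd].
  case: (directed D (p.1 ++ p.2)).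
  - by move=> B; rewrite mem_cat => /orP[/p1|/p2].
  - by move=> IL; left; split=> // B Bp; apply: IL; rewrite mem_cat Bp ?orbT.
  - move=> [s Ds sL]; right; exists s => //.
    by split=> // B Bp; apply: sL; rewrite mem_cat Bp ?orbT.
have Jind t : cindependent (J t) /\ cindependent (J t `|` [set A t]).
  elim: t / (ltwf t) => t _ IH.
  have Jt : cindependent (J t).
    move=> p /cond_dir[/Iind//|[s /IH[_ +]]]; exact.
  split=> //; rewrite AE.
  by have [] := stepP (J t, pi t) (Jinf t) Jt (Jsmall t).
pose I' := I `|` range A.
have JI' t : J t `|` [set A t] `<=` I'.
  by move=> B [[IB|[s _ <-]]|->]; [left|right; exists s|right; exists t].
exists I'; split; last by left.
- apply/independent_familyP; split; first by apply: sub_infinite_set Iinf; left.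
  by move=> p /cond_dir[/Iind//|[s _]]; have [_] := Jind s; exact.
- apply/everywhere_selectiveP => f p pI'.
  have [t pt pJ] : exists2 t, pi t = (f, p) & condition_on (J t) p.
    case: (cond_dir _ _ pI') => [pI|[s _ pJs]].
      have [t pt] : [set w | pi w = (f, p)] !=set0.
        apply/set0P/eqP => E; have := piP (f, p); rewrite E => /card_le0P /seteqP[sub _].
        exact: (sub id).
      by exists t => //; exact: condition_onS pI.
    (* Fewer than c stages come up to [s], so they cannot include all c occurrences of the task. *)
    apply: contrapT => H.
    have sub : [set w | pi w = (f, p)] `<=` [set w | lt w s] `|` [set s].
      move=> t pt; case: (lttri t s) => [ts|->|st]; [by left|by right|].
      by case: H; exists t => //; apply: condition_onS pJs; exact: Jlt.
    have := card_le_trans (piP (f, p)) (subset_card_le sub).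
    move=> /continuum_setU[/ltsmall//|le].
    by apply: infinite_continuum; exact: card_le_finite le (finite_set1 s).
  have [_ sol] := stepP (J t, pi t) (Jinf t) (Jind t).1 (Jsmall t).
  have := sol; rewrite pt /= => /(_ pJ)[q [qI pq fq]].
  exists q; split=> //; apply: condition_onS qI.
  by have := JI' t; rewrite AE pt.
Qed.

(** * A small family with no selective extension *)

(** Diagonalize: the function equal at [n] to the [n]-th listed function meets every member of a
    finite list. *)
Lemma mc_family_infinite (H : set (nat -> nat)) : mc_family H -> infinite_set H.
Proof.
move=> Hmc /finite_seqP[s Hs].
have [h] := Hmc (fun n => nth id s n n); rewrite Hs /= => hs /(_ (index h s)).
by rewrite nth_index.
Qed.

(** The block exceeds [n], so that restrictions eventually separate distinct functions, and contains
    the codes of all pairs [(n, i)] with [i <= n], where a diagonal function will copy the [i]-th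
    guess. *)
Definition block (n : nat) : nat :=
  (n + \max_(i < n.+1) choice.pickle (n, nat_of_ord i)).+1.

Lemma pickle_block n i : (i <= n)%N -> (choice.pickle (n, i) < block n)%N.
Proof.
move=> i_n; rewrite ltnS; apply: leq_trans (leq_addl _ _).
have i_lt : (i < n.+1)%N by [].
exact: (leq_bigmax (F := fun i : 'I_n.+1 => choice.pickle (n, nat_of_ord i)) (Ordinal i_lt)).
Qed.

(* A number codes a pair (n, S), where S lists guesses at the restriction of a
   function to [block n]; only the first n.+1 guesses count. *)
Definition slalom (x : nat) : nat * seq (seq nat) :=
  odflt (0, [::]) (choice.unpickle x).

Definition captures (h : nat -> nat) : set nat :=
  [set x | mkseq h (block (slalom x).1) \in
             take (slalom x).1.+1 (slalom x).2].

Lemma separating_bound (L : seq ((nat -> nat) * (nat -> nat))) :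
  (forall u, u \in L -> u.1 <> u.2) ->
  exists M, forall u, u \in L -> exists2 i, (i < M)%N & u.1 i <> u.2 i.
Proof.
elim: L => [|v L IH] LN; first by exists 0.
have [|M MP] := IH; first by move=> u uL; apply: LN; rewrite inE uL orbT.
have [i vi] : exists i, v.1 i <> v.2 i.
  apply: contrapT => H; apply: (LN v (mem_head _ _)); apply/funext => i.
  by apply: contrapT => vi; apply: H; exists i.
exists (maxn i.+1 M) => u; rewrite inE => /predU1P[->|/MP[k kM uk]].
  by exists i => //; exact: leq_maxl.
by exists k => //; exact: leq_trans kM (leq_maxr _ _).
Qed.

(** The guesses are the restrictions of the members of [P] to [block n], with [n] so large that all
    of them count and that they differ from the restrictions of members of [N]. *)
Lemma captures_independent (P N : seq (nat -> nat)) :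
  (forall p, p \in P -> p \notin N) ->
  exists x, (forall p, p \in P -> captures p x) /\
            (forall q, q \in N -> ~ captures q x).
Proof.
move=> PN; have [|M MP] := @separating_bound [seq (p, q) | p <- P, q <- N].
  by move=> _ /allpairsP[[p q] [/= pP qN ->]] /= E; have := PN p pP; rewrite E qN.
pose n := M + size P.
pose x := choice.pickle (n, [seq mkseq p (block n) | p <- P]).
have Ex : slalom x = (n, [seq mkseq p (block n) | p <- P]).
  by rewrite /slalom choice.pickleK.
have Ecap h : captures h x <-> mkseq h (block n) \in [seq mkseq p (block n) | p <- P].
  rewrite /captures /= Ex /= take_oversize // size_map.
  exact: leq_trans (leq_addl _ _) (leqnSn _).
exists x; split=> [p pP|q qN /Ecap /mapP[p pP E]].
  by apply/Ecap/mapP; exists p.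
have [|i iM ne] := MP (p, q); first exact: allpairs_f.
have i_block : (i < block n)%N.
  by rewrite ltnS; apply: leq_trans (leq_addr _ _); apply: leq_trans (ltnW iM) (leq_addr _ _).
by apply: ne; rewrite /= -(nth_mkseq 0 p i_block) -(nth_mkseq 0 q i_block) E.
Qed.

Lemma captures_inj : injective captures.
Proof.
move=> p q E; apply: contrapT => pq.
have [|x [/(_ p) px /(_ q) qx]] := @captures_independent [:: p] [:: q].
  by move=> r; rewrite inE => /eqP rp; rewrite inE; apply/eqP; rewrite rp.
by apply: qx; rewrite ?mem_head // -E; apply: px; rewrite mem_head.
Qed.

Definition shift (j : nat) (h : nat -> nat) (n : nat) : nat :=
  if n is m.+1 then h m else j.

(* Prepending an arbitrary value j provides infinitely many members of the
   family for each h, so that some of them avoid any given condition. *)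
Definition capture_family (H : set (nat -> nat)) : set (set nat) :=
  [set captures (shift u.2 u.1) | u in H `*` [set: nat]].

Lemma captures_shift_inj h : injective (fun j => captures (shift j h)).
Proof. by move=> i j /captures_inj /(congr1 (fun g => g 0)). Qed.

Lemma capture_family_infinite H : mc_family H -> infinite_set (capture_family H).
Proof.
move=> /(_ id)[h Hh _]; apply/infiniteP.
apply: (card_le_fun (f := fun j => captures (shift j h))) => [j _|i j _ _].
  by exists (h, j).
exact: captures_shift_inj.
Qed.

Lemma capture_family_independent H : cindependent (capture_family H).
Proof.
move=> p [p1 p2 pd].
have /choice[e eP] : forall A, exists g, capture_family H A -> captures g = A.
  move=> A; have [[u _ uA]|] := pselect (capture_family H A); last by exists id.
  by exists (shift u.2 u.1).
have [|x [x1 x2]] := @captures_independent (map e p.1) (map e p.2).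
  move=> g /mapP[A A1 ->]; apply/negP => /mapP[B B2 E]; apply: (pd A A1).
  by rewrite -(eP _ (p1 _ A1)) E (eP _ (p2 _ B2)).
exists x; split=> A Ap.
  by rewrite -(eP _ (p1 _ Ap)); apply: x1; exact: map_f.
by rewrite -(eP _ (p2 _ Ap)); apply: x2; exact: map_f.
Qed.

Lemma card_capture_family H : mc_family H -> capture_family H #<= H.
Proof.
move=> /mc_family_infinite Hinf; apply: card_le_trans (card_image_le _ _) _.
apply: card_le_setX => //; exact/infiniteP.
Qed.

Lemma injective_eventually_notin (T : eqType) (u : nat -> T) (L : seq T) :
  injective u -> exists M, forall j, (M <= j)%N -> u j \notin L.
Proof.
move=> uI; elim: L => [|A L [M MP]]; first by exists 0.
have [[k kA]|no] := pselect (exists k, u k = A).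
  exists (maxn k.+1 M) => j; rewrite geq_max => /andP[kj /MP jL].
  rewrite inE negb_or jL andbT -kA; apply/eqP => /uI jk.
  by move: kj; rewrite jk ltnn.
exists M => j /MP jL; rewrite inE negb_or jL andbT.
by apply/eqP => jA; apply: no; exists j.
Qed.

Lemma cindependent_add I q (L : seq (set nat)) :
    cindependent I -> condition_on I q ->
    (forall A, A \in L -> I A) -> (forall A, A \in L -> A \notin q.2) ->
  exists2 x, ccell q x & forall A, A \in L -> A x.
Proof.
move=> Iind [q1 q2 qd] LI Lq.
have [|x [x1 x2]] := Iind (L ++ q.1, q.2).
  split=> //= A; rewrite mem_cat; first by move=> /orP[/LI|/q1].
  by move=> /orP[/Lq/negP|]; last exact: qd.
exists x; first by split=> // A Aq; apply: x1; rewrite mem_cat Aq orbT.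
by move=> A AL; apply: x1; rewrite mem_cat AL.
Qed.

Lemma capture_family_not_selective H I :
    mc_family H -> cindependent I -> capture_family H `<=` I -> ~ selective I.
Proof.
move=> Hmc Iind HI /selectiveP/(_ (fun x => (slalom x).1))[q qI].
have late h : exists M, forall j, (M <= j)%N -> captures (shift j h) \notin q.2.
  by apply: injective_eventually_notin; exact: captures_shift_inj.
have inI h j : H h -> I (captures (shift j h)).
  by move=> Hh; apply: HI; exists (h, j).
case=> [finj|[c fc]].
  (* At most one point of the cell has first component [n]; [S n] is its list of guesses, empty by
     default. *)
  have /choice[S SP] : forall n, exists s, forall x, ccell q x ->
      (slalom x).1 = n -> (slalom x).2 = s.
    move=> n; have [[x qx xn]|no] := pselect (exists2 x, ccell q x & (slalom x).1 = n).
      exists (slalom x).2 => y qy yn; congr (slalom _).2.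
      by apply: finj; rewrite ?yn //; exact: mem_set.
    by exists [::] => x qx xn; case: no; exists x.
  (* At the code of [(n, i)], [g] copies the value of the [i]-th guess in [S n], so it meets every
     function captured by a point of the cell. *)
  pose g y := if choice.unpickle y is Some (n, i)
              then nth 0 (nth [::] (S n) i) y else 0.
  (* [Hmc] is applied to [g] moved down by one, since [shift] puts [j] in front of [h]. Taking [j]
     above [g 0] prevents a match at 0; taking it at least [M] keeps the set out of [q.2]. *)
  have [h Hh gh] := Hmc (fun m => g m.+1); have [M MP] := late h.
  pose j := M + (g 0).+1.
  have gj y : g y <> shift j h y.
    case: y => [|m] /=; last exact: gh.
    by move=> E; have := leq_addl M (g 0).+1; rewrite -/j -E ltnn.
  have [||x qx /(_ _ (mem_head _ _))] :=
      @cindependent_add I q [:: captures (shift j h)] Iind qI.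
  - by move=> A; rewrite inE => /eqP ->; exact: inI.
  - by move=> A; rewrite inE => /eqP ->; apply: MP; exact: leq_addr.
  rewrite /captures /=; set n := (slalom x).1; rewrite (SP n x qx erefl).
  move=> /(nthP [::])[i]; rewrite size_take_min leq_min => /andP[i_n _].
  rewrite nth_take // => Ei.
  apply: (gj (choice.pickle (n, i))); rewrite /g choice.pickleK Ei nth_mkseq //.
  exact: pickle_block.
(* If the first component is always [c], then [c.+2] sets of the family share a point of the cell,
   and its first [c.+1] guesses would contain [c.+2] distinct restrictions. *)
have [h Hh _] := Hmc id; have [M MP] := late h.
have [||x qx xL] := @cindependent_add I q
    [seq captures (shift j h) | j <- iota M c.+2] Iind qI.
- by move=> A /mapP[j _ ->]; exact: inI.
- by move=> A /mapP[j + ->]; rewrite mem_iota => /andP[Mj _]; exact: MP.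
have sub : {subset [seq mkseq (shift j h) (block c) | j <- iota M c.+2]
            <= take c.+1 (slalom x).2}.
  move=> s /mapP[j jM ->].
  by have := xL _ (map_f (fun j => captures (shift j h)) jM); rewrite /captures /= fc.
have uq : uniq [seq mkseq (shift j h) (block c) | j <- iota M c.+2].
  (* The restrictions differ at 0, where [shift j h] is [j]; [block c] is positive. *)
  rewrite map_inj_uniq ?iota_uniq // => i j /(congr1 (head 0)).
  by rewrite /block /mkseq.
have := uniq_leq_size uq sub; rewrite size_map size_iota => le.
by move: le; rewrite size_take_min leq_min ltnn.
Qed.

(** * The implications between the three statements *)

Lemma generic_everywhere_selective :
  is_mc continuum -> exist_generically everywhere_selective.
Proof.
move=> [_ mcC] I /independent_familyP[Iinf Iind] [_ Ismall].
exact: exists_everywhere_selective.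
Qed.

Lemma everywhere_selective_selective I : everywhere_selective I -> selective I.
Proof.
move=> /everywhere_selectiveP H; apply/selectiveP => f.
have [|q [qI _ fq]] := H f ([::], [::]); first by split.
by exists q.
Qed.

Lemma generic_selective_is_mc : exist_generically selective -> is_mc continuum.
Proof.
move=> gen; split.
  (* The family of all functions qualifies: the successor of [g] is nowhere equal to [g]. *)
  exists setT; last exact: card_eqxx.
  by move=> g; exists (fun n => (g n).+1) => // n /esym/eqP; rewrite (gtn_eqF (ltnSn _)).
move=> H Hmc; apply: contrapT => Hsmall.
have leH := card_capture_family Hmc.
have [||I' [/independent_familyP[_ I'ind] I'sel sub]] := gen (capture_family H).
- apply/independent_familyP; split; first exact: capture_family_infinite.
  exact: capture_family_independent.
- split; first exact: card_le_trans leH (subset_card_le _).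
  by move=> le; apply: Hsmall; exact: card_le_trans le leH.
exact: capture_family_not_selective Hmc I'ind sub I'sel.
Qed.

Theorem theorem1 :
  (is_mc continuum <-> exist_generically everywhere_selective) /\
  (exist_generically everywhere_selective <-> exist_generically selective).
Proof.
have weaken : exist_generically everywhere_selective -> exist_generically selective.
  move=> gen I Iind Ismall; have [I' [I'ind I'sel sub]] := gen I Iind Ismall.
  by exists I'; split=> //; exact: everywhere_selective_selective.
split; split=> //.
- exact: generic_everywhere_selective.
- by move/weaken; exact: generic_selective_is_mc.
- by move/generic_selective_is_mc; exact: generic_everywhere_selective.
Qed.
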